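(* Let $p\ge2$ be an integer, $\mu\ge0$, $s>0$, $M>0$, and $C=\frac1p\left(\frac{M}{p-1}\right)^{p-1}$. Then there is a constant $K>0$ (depending only on $p,\mu,s,M$) such that the following holds. Let $h:\mathbb{R}^n\to\mathbb{R}$ be $1$-uniformly convex of order $p$, let $f:\mathbb{R}^n\to\mathbb{R}$ be $\mu$-uniformly convex (possibly $\mu=0$) with respect to $h$ and $\frac{(p-1)!}{s}$-smooth of order $p-1$, with a minimizer $x^*$, and let $G_{p,M}$ be a tensor update operator with constant $M$. Define $A_0=0$ and, for $k\ge0$, let $A_{k+1}$ be the largest real number $A$ satisfying $$(A-A_k)^p-Cp^psA^{p-1}(1+\mu A_k)\le0.$$ Let the iterates of the unified accelerated tensor method be generated from $x_0=z_0\in\mathbb{R}^n$ by, for $k\ge0$, $$y_k=x_k+\frac{A_{k+1}-A_k}{A_{k+1}}(z_k-x_k),\qquad x_{k+1}=G_{p,M}(y_k),$$ $$z_{k+1}=\arg\min_z\left\{\frac{A_{k+1}-A_k}{1+\mu A_k}\left(\langle\nabla f(x_{k+1}),z\rangle+\mu D_h(z,x_{k+1})\right)+D_h(z,z_k)\right\}.$$ Then for all $k\ge1$, $$f(x_k)-f(x^* )\le K\min\left\{\frac{1}{k^p},\left(1+C^{1/p}p\mu^{1/p}s^{1/p}\right)^{-k}\right\}D_h(x^*,x_0).$$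
   Context: The functions $f,h$ are continuously differentiable ($f$ also $p-1$ times differentiable). $D_g(y,x)=g(y)-g(x)-\langle\nabla g(x),y-x\rangle$. $h$ is $1$-uniformly convex of order $p$ if $D_h(y,x)\ge\frac1p\|y-x\|^p$ for all $x,y$. $f$ (convex) is $\mu$-uniformly convex with respect to $h$ if $D_f(x,y)\ge\mu D_h(x,y)$ for all $x,y$. $f$ is $L$-smooth of order $p-1$ if $\|\nabla^{p-1}f(y)-\nabla^{p-1}f(x)\|\le L\|y-x\|$ for all $x,y$. Tensor update operator: for $N>0$, $G_{p,s,N}(y)=\arg\min_x\left\{f_{p-1}(x;y)+\frac{N}{ps}\|x-y\|^p\right\}$, where $f_{p-1}(x;y)=\sum_{i=0}^{p-1}\frac{1}{i!}\nabla^if(y)(x-y)^i$ is the $(p-1)$-st order Taylor approximation of $f$ at $y$. $G_{p,M}:\mathbb{R}^n\to\mathbb{R}^n$ denotes such an operator, with $N$ chosen so that for every $y$, the point $x=G_{p,M}(y)$ satisfies $$\langle\nabla f(x),y-x\rangle\ge Ms^{\frac{1}{p-1}}\|\nabla f(x)\|^{\frac{p}{p-1}}.$$ *)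

(* Defs.v *)
From HB Require Import structures.
From mathcomp Require Export all_boot all_order all_algebra.
From mathcomp Require Export all_classical all_reals all_analysis.

Set Implicit Arguments.
Unset Strict Implicit.
Unset Printing Implicit Defensive.

Import Order.TTheory GRing.Theory Num.Theory.
Export numFieldNormedType.Exports.

Local Open Scope classical_set_scope.
Local Open Scope ring_scope.

Definition dotv (R : realType) (n : nat) (u v : 'rV[R]_n) : R :=
  \sum_(i < n) u 0 i * v 0 i.

(* The Euclidean norm; the canonical norm `|u| of 'rV[R]_n is the sup norm.
   Both induce the same topology, so differentiability and continuity below
   are the usual ones. *)
Definition enorm (R : realType) (n : nat) (u : 'rV[R]_n) : R :=
  Num.sqrt (dotv u u).

Definition grad (R : realType) (n : nat) (f : 'rV[R]_n -> R) (x : 'rV[R]_n) :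
    'rV[R]_n :=
  \row_(i < n) 'D_(delta_mx 0 i) f x.

Definition continuously_differentiable (R : realType) (n : nat)
    (f : 'rV[R]_n -> R) : Prop :=
  (forall x, differentiable f x) /\ continuous (grad f).

(* [:: v_1; ...; v_k] |-> D_{v_1} (... (D_{v_k} f)) *)
Definition iter_derive (R : realType) (n : nat) (f : 'rV[R]_n -> R)
    (vs : seq 'rV[R]_n) : 'rV[R]_n -> R :=
  foldr (fun v g => 'D_v g) f vs.

(* The k-th derivative of f at x, as a k-linear form:
   nabla f k x (v_1, ..., v_k) = \nabla^k f(x)[v_1, ..., v_k]. *)
Definition nabla (R : realType) (n : nat) (f : 'rV[R]_n -> R) (k : nat)
    (x : 'rV[R]_n) (v : k.-tuple 'rV[R]_n) : R :=
  iter_derive f v x.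

(* f is k times (Frechet) differentiable: in finite dimension \nabla^j f is
   differentiable iff each of its components \nabla^j f(.)[v_1, ..., v_j] is. *)
Definition times_differentiable (R : realType) (n : nat) (k : nat)
    (f : 'rV[R]_n -> R) : Prop :=
  forall j : nat, (j < k)%N ->
  forall (v : j.-tuple 'rV[R]_n) (x : 'rV[R]_n),
    differentiable (fun y => nabla f y v) x.

Definition tensor_norm (R : realType) (n k : nat)
    (T : k.-tuple 'rV[R]_n -> R) : \bar R :=
  ereal_sup [set (`|T v|)%:E | v in
    [set v : k.-tuple 'rV[R]_n | forall i, enorm (tnth v i) <= 1]].

Definition smooth_of_order (R : realType) (n : nat) (k : nat) (L : R)
    (f : 'rV[R]_n -> R) : Prop :=
  forall x y : 'rV[R]_n,
    (tensor_norm (fun v : k.-tuple 'rV[R]_n =>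
        (nabla f y v - nabla f x v)%R)
       <= (L * enorm (y - x))%:E)%E.

Definition bregman (R : realType) (n : nat) (g : 'rV[R]_n -> R)
    (y x : 'rV[R]_n) : R :=
  g y - g x - dotv (grad g x) (y - x).

(* sigma-uniform convexity of order p, used with sigma = 1 *)
Definition uniformly_convex (R : realType) (n : nat) (p : nat) (sigma : R)
    (h : 'rV[R]_n -> R) : Prop :=
  forall x y : 'rV[R]_n, sigma / p%:R * enorm (y - x) ^+ p <= bregman h y x.

Definition uniformly_convex_wrt (R : realType) (n : nat) (mu : R)
    (h f : 'rV[R]_n -> R) : Prop :=
  convex_function [set: 'rV[R]_n] f /\
  forall x y : 'rV[R]_n, mu * bregman h x y <= bregman f x y.

Definition minimizer (R : realType) (T : Type) (F : T -> R) (x : T) : Prop :=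
  forall y : T, F x <= F y.

Definition largest (R : realType) (E : set R) (a : R) : Prop :=
  E a /\ ubound E a.

(* The Taylor polynomial of f at y with terms i = 0, ..., k. *)
Definition taylor (R : realType) (n : nat) (k : nat) (f : 'rV[R]_n -> R)
    (x y : 'rV[R]_n) : R :=
  \sum_(i < k.+1) (i`!%:R)^-1 * nabla f y (nseq_tuple i (x - y)).

Definition tensor_update (R : realType) (n : nat) (p : nat) (s M : R)
    (f : 'rV[R]_n -> R) (G : 'rV[R]_n -> 'rV[R]_n) : Prop :=
  exists2 N : R, 0 < N &
  forall y : 'rV[R]_n,
    minimizer (fun x => taylor p.-1 f x y + N / (p%:R * s) * enorm (x - y) ^+ p)
      (G y) /\
    M * s `^ (p.-1%:R)^-1 * enorm (grad f (G y)) `^ (p%:R / p.-1%:R)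
      <= dotv (grad f (G y)) (y - G y).

Definition rate_const (R : realType) (p : nat) (M : R) : R :=
  (p%:R)^-1 * (M / p.-1%:R) ^+ p.-1.

(* Main.v *)
Require Import Defs.
From mathcomp Require Import all_boot all_order all_algebra.
From mathcomp Require Import all_classical all_reals all_analysis.
From mathcomp Require Import ring lra.
Import Order.TTheory GRing.Theory Num.Theory.
Import numFieldNormedType.Exports.
Local Open Scope classical_set_scope.
Local Open Scope ring_scope.
Set Implicit Arguments.
Unset Strict Implicit.
Unset Printing Implicit Defensive.

(** The proof is a Lyapunov argument. Writing D for the Bregman distance of h,
    the energy

      E_k = A_k (f(x_k) - f(xstar)) + (1 + mu A_k) D(xstar, z_k)

    does not increase (potential_step), and E_0 = D(xstar, x_0), so the gap
    f(x_k) - f(xstar) is at most D(xstar, x_0) / A_k; the two rates are then two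
    lower bounds for A_k.

    For the decrease of E_k, put g = grad f(x_{k+1}) and
    al = A_{k+1} - A_k. The first-order condition for z_{k+1}, tested against
    xstar - z_{k+1}, becomes through the three-point identity for D an exact
    formula for (1 + mu A_{k+1}) D(xstar, z_{k+1}). Adding the inequality
    mu D <= D_f at the pair (xstar, x_{k+1}) with weight al and convexity at the
    pair (x_k, x_{k+1}) with weight A_k, and using that
    A_{k+1} y_k = A_k x_k + al z_k, one is left with

      E_{k+1} - E_k <= - A_{k+1} <g, y_k - x_{k+1}>
                       + al <g, z_k - z_{k+1}> - (1 + mu A_k) D(z_{k+1}, z_k).

    The first term is at most - A_{k+1} M s^(1/(p-1)) |g|^(p/(p-1)) by the
    property of the tensor update, and the last one at most
    - (1 + mu A_k) |z_{k+1} - z_k|^p / p by uniform convexity of h. The Young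
    inequality (scaled_Young) bounds the middle term by the opposite of the
    sum of these two as soon as al^p <= C p^p s A_{k+1}^(p-1) (1 + mu A_k): this
    is where the value of C comes from.

    Conversely, maximality of A_{k+1} turns that inequality into an equality
    (largest_ge gives the other half). Dropping mu A_k, the p-th root of A_k
    grows by at least (C s)^(1/p) at each step (root_growth), so that
    A_k >= C s k^p (weight_poly_ge). Keeping only mu A_k, and bounding
    A_{k+1}^(p-1) from below by A_k^(p-1), gives
    A_{k+1} - A_k >= p (C mu s)^(1/p) A_k, hence the geometric growth of A_k
    (weight_geom_ge).

    Throughout, p is written q.+1. *)

(** * Inner product, gradients and first-order optimality *)

Section InnerProduct.
Variables (R : realType) (n : nat).
Implicit Types (u v w : 'rV[R]_n) (a : R).

Lemma dotvC u v : dotv u v = dotv v u.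
Proof. by apply: eq_bigr => i _; rewrite mulrC. Qed.

Lemma dotvDr u v w : dotv u (v + w) = dotv u v + dotv u w.
Proof. by rewrite -big_split; apply: eq_bigr => i _; rewrite mxE mulrDr. Qed.

Lemma dotvZr a u v : dotv u (a *: v) = a * dotv u v.
Proof. by rewrite mulr_sumr; apply: eq_bigr => i _; rewrite mxE mulrCA. Qed.

Lemma dotvNr u v : dotv u (- v) = - dotv u v.
Proof. by rewrite -scaleN1r dotvZr mulN1r. Qed.

Lemma dotvBr u v w : dotv u (v - w) = dotv u v - dotv u w.
Proof. by rewrite dotvDr dotvNr. Qed.

Lemma dotvZl a u v : dotv (a *: u) v = a * dotv u v.
Proof. by rewrite ![dotv _ v]dotvC dotvZr. Qed.

Lemma dotvBl u v w : dotv (u - v) w = dotv u w - dotv v w.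
Proof. by rewrite ![dotv _ w]dotvC dotvBr. Qed.

Lemma dotv_ge0 u : 0 <= dotv u u.
Proof. by apply: sumr_ge0 => i _; rewrite -expr2 sqr_ge0. Qed.

Lemma enorm_ge0 u : 0 <= enorm u.
Proof. exact: sqrtr_ge0. Qed.

Lemma enorm_sqr u : enorm u ^+ 2 = dotv u u.
Proof. by rewrite sqr_sqrtr // dotv_ge0. Qed.

Lemma enormN u : enorm (- u) = enorm u.
Proof. by rewrite /enorm dotvNr dotvC dotvNr opprK. Qed.

Lemma enorm_eq0 u : enorm u = 0 -> u = 0.
Proof.
move=> u0; have := enorm_sqr u; rewrite u0 expr0n /= => /esym/eqP.
rewrite psumr_eq0; last by move=> i _; rewrite -expr2 sqr_ge0.
move=> /allP uE; apply/rowP => i; rewrite mxE; apply/eqP.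
by have := uE i; rewrite mem_index_enum /= mulf_eq0 orbb; apply.
Qed.

(** Expand the squared norm of |v| u - |u| v, and divide by |u| |v|. *)
Lemma CauchySchwarz_dotv u v : dotv u v <= enorm u * enorm v.
Proof.
have [u0|u_neq0] := eqVneq (enorm u) 0.
  by rewrite u0 mul0r (enorm_eq0 u0) dotvC -(scale0r 0) dotvZr mul0r.
have [v0|v_neq0] := eqVneq (enorm v) 0.
  by rewrite v0 mulr0 (enorm_eq0 v0) -(scale0r 0) dotvZr mul0r.
have uv_gt0 : 0 < enorm u * enorm v.
  by rewrite mulr_gt0 // lt_def enorm_ge0 ?u_neq0 ?v_neq0.
have := dotv_ge0 (enorm v *: u - enorm u *: v).
rewrite !(dotvBl, dotvBr, dotvZl, dotvZr) -!enorm_sqr (dotvC v u) => ge0.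
rewrite -(ler_pM2l uv_gt0); lra.
Qed.

Lemma derive_grad (g : 'rV[R]_n -> R) u v :
  differentiable g u -> 'D_v g u = dotv (grad g u) v.
Proof.
move=> dg; rewrite deriveE // {1}(row_sum_delta v) linear_sum.
apply: eq_bigr => i _; rewrite linearZ /= mxE deriveE //.
by rewrite mulrC.
Qed.

(** The difference quotients of a linear form are constant. *)
Lemma is_derive_dotv l u v : is_derive u v (dotv l) (dotv l v).
Proof.
have quotE : {near 0^', (fun=> dotv l v) =1
    (fun t : R => t^-1 *: ((dotv l \o shift u) (t *: v) - dotv l u))}.
  near=> t; rewrite /= dotvDr addrK dotvZr [_ *: _]mulrA mulVf ?mul1r //.
  by near: t; exact: nbhs_dnbhs_neq.
have cvgl : (fun t : R => t^-1 *: ((dotv l \o shift u) (t *: v) - dotv l u))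
    @ 0^' --> dotv l v.
  by apply: cvg_trans (near_eq_cvg quotE) _; exact: cvg_cst.
by split; [apply/cvg_ex; exists (dotv l v)|exact: cvg_lim cvgl].
Unshelve. all: by end_near. Qed.

(** The derivative is the limit of the difference quotients from the right,
    which are nonnegative. *)
Lemma derive_minimizer_ge0 (g : 'rV[R]_n -> R) u v :
  derivable g u v -> minimizer g u -> 0 <= 'D_v g u.
Proof.
move=> dg ming; rewrite /derive cvg_at_rightE //; apply: limr_ge.
  rewrite -(cvg_at_rightE (fun h : R => h^-1 *: ((g \o shift u) _ - g u))) //.
  apply: cvg_trans dg; apply: cvg_app.
  move=> A [e e0 Ae]; exists e => // x xe x0; apply: Ae => //.
  exact: lt0r_neq0.
near=> t; rewrite mulr_ge0 ?subr_ge0 ?ming // invr_ge0; apply: ltW.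
by near: t; exact: nbhs_right_gt.
Unshelve. all: by end_near. Qed.

(** The derivatives along v and along - v are both nonnegative, and opposite. *)
Lemma grad_minimizer (h : 'rV[R]_n -> R) (c d : R) l u v :
  differentiable h u -> minimizer (fun w => c * h w + dotv l w + d) u ->
  c * dotv (grad h u) v + dotv l v = 0.
Proof.
move=> dh minh.
have ge0 w : 0 <= c * dotv (grad h u) w + dotv l w.
  have dhw : is_derive u w h (dotv (grad h u) w).
    by split; [exact: diff_derivable|exact: derive_grad].
  have dlw := is_derive_dotv l u w.
  have dF : is_derive u w (c \*: h + dotv l + cst d)
      (c *: dotv (grad h u) w + dotv l w + 0) by apply: is_deriveD.
  rewrite addr0 in dF.
  have <- : 'D_w (c \*: h + dotv l + cst d) u =
     c * dotv (grad h u) w + dotv l w by exact: derive_val.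
  by apply: derive_minimizer_ge0.
apply/eqP; rewrite eq_le ge0 andbT -oppr_ge0.
by have := ge0 (- v); rewrite !dotvNr mulrN -opprD.
Qed.

End InnerProduct.

(** * Scalar inequalities *)

Section ScalarInequalities.
Variable R : realType.
Implicit Types (a b c t u : R).

Lemma exprn_powRV a (p : nat) : 0 <= a -> (0 < p)%N -> (a `^ p%:R^-1) ^+ p = a.
Proof.
move=> a_ge0 p_gt0; rewrite -powR_mulrn ?powR_ge0 // -powRrM mulVf ?powRr1 //.
by rewrite pnatr_eq0 -lt0n.
Qed.

Lemma weighted_AGM (q : nat) a b : 0 <= a -> 0 <= b ->
  a * b ^+ q <= ((a + b *+ q) / q.+1%:R) ^+ q.+1.
Proof.
move=> a_ge0 b_ge0.
pose E (i : 'I_q.+1) := if i == ord0 then a else b.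
have [|/= + _] := @leif_AGM R _ predT E.
  by move=> i _; rewrite /E; case: ifP.
rewrite cardT size_enum_ord !big_ord_recl /E eqxx /=.
by rewrite prodr_const sumr_const card_ord.
Qed.

(** The Young inequality for the exponents q + 1 and (q + 1) / q, with u^q
    standing for the dual norm. It is the arithmetic-geometric mean inequality
    for c t^(q+1) and q copies of (q+1)/q b u^(q+1), whose mean is the
    right-hand side and whose product is at least (al u^q t)^(q+1) by the
    assumption on al. *)
Lemma scaled_Young (q : nat) (al b c t u : R) : (0 < q)%N ->
  0 <= b -> 0 <= c -> 0 <= t -> 0 <= u ->
  al ^+ q.+1 * q%:R ^+ q <= c * (q.+1%:R * b) ^+ q ->
  al * u ^+ q * t <= c / q.+1%:R * t ^+ q.+1 + b * u ^+ q.+1.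
Proof.
move=> q_gt0 b_ge0 c_ge0 t_ge0 u_ge0 al_le.
have q0 : q%:R != 0 :> R by rewrite pnatr_eq0 -lt0n.
have p0 : q.+1%:R != 0 :> R by rewrite pnatr_eq0.
set r := (X in _ <= X).
have r_ge0 : 0 <= r by rewrite addr_ge0 // mulr_ge0 ?exprn_ge0 // divr_ge0.
have [l_le0|l_gt0] := leP (al * u ^+ q * t) 0; first exact: le_trans r_ge0.
rewrite -(@ler_pXn2r _ q.+1) ?nnegrE //; last exact: ltW.
have -> : r = (c * t ^+ q.+1 + (q.+1%:R / q%:R * b * u ^+ q.+1) *+ q) / q.+1%:R.
  rewrite /r -[_ *+ q]mulr_natr; move: (q.+1%:R) p0 (q%:R) q0 => m m0 m' m'0.
  by field; rewrite m0 m'0.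
apply: le_trans (weighted_AGM q _ _); last 2 first.
- by rewrite mulr_ge0 ?exprn_ge0.
- by rewrite !mulr_ge0 ?exprn_ge0 ?invr_ge0.
have -> : (al * u ^+ q * t) ^+ q.+1 =
    al ^+ q.+1 * q%:R ^+ q * ((u ^+ q) ^+ q.+1 * t ^+ q.+1 / q%:R ^+ q).
  by rewrite !exprMn; field; rewrite expf_neq0.
have -> : c * t ^+ q.+1 * (q.+1%:R / q%:R * b * u ^+ q.+1) ^+ q =
    c * (q.+1%:R * b) ^+ q * ((u ^+ q) ^+ q.+1 * t ^+ q.+1 / q%:R ^+ q).
  rewrite !exprMn exprVn (exprAC u); ring.
by rewrite ler_wpM2r // divr_ge0 ?mulr_ge0 ?exprn_ge0.
Qed.

(** If the inequality were strict at B, continuity would give a larger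
    element of the set. *)
Lemma largest_ge (p q : nat) (A k m B : R) :
  largest [set a : R | (a - A) ^+ p - k * a ^+ q * m <= 0] B ->
  k * B ^+ q * m <= (B - A) ^+ p.
Proof.
move=> [_ Bub]; rewrite leNgt -subr_lt0; apply/negP => lt0.
pose P : {poly R} := ('X - A%:P) ^+ p - k *: 'X^q * m%:P.
have PE a : P.[a] = (a - A) ^+ p - k * a ^+ q * m by rewrite !hornerE.
rewrite -PE in lt0.
have cP : P.[a] @[a --> B^'+] --> P.[B].
  by apply: cvg_at_right_filter; exact: continuous_horner.
have /filter_ex [a /= [Pa Ba]] : \forall a \near B^'+, P.[a] < 0 /\ B < a.
  near=> a; split; near: a; last exact: nbhs_right_gt.
  exact: cvgr_lt cP _ lt0.
have /Bub : [set a : R | (a - A) ^+ p - k * a ^+ q * m <= 0] a.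
  by rewrite /= -PE ltW.
by rewrite leNgt Ba.
Unshelve. all: by end_near. Qed.

Lemma exprSB_le (q : nat) a b : 0 <= a -> a <= b ->
  b ^+ q.+1 - a ^+ q.+1 <= q.+1%:R * b ^+ q * (b - a).
Proof.
move=> a_ge0 ab; rewrite subrXX mulrC ler_wpM2r ?subr_ge0 //.
rewrite -[q.+1 in X in _ <= X]card_ord mulr_natl -sumr_const.
apply: ler_sum => i _ /=.
have iq : (i <= q)%N by rewrite -ltnS.
rewrite -[in X in _ <= X](subnK iq) exprD ler_wpM2l ?exprn_ge0 //.
  exact: le_trans ab.
by rewrite lerXn2r ?nnegrE // (le_trans a_ge0).
Qed.

(** Here a and b are the (q+1)-th roots of two consecutive weights. By
    exprSB_le, (q+1) tau b^q <= b^(q+1) - a^(q+1) <= (q+1) b^q (b - a). *)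
Lemma root_growth (q : nat) (tau a b : R) :
  0 <= tau -> 0 <= a -> 0 < b -> a <= b ->
  (q.+1%:R * tau * b ^+ q) ^+ q.+1 <= (b ^+ q.+1 - a ^+ q.+1) ^+ q.+1 ->
  a + tau <= b.
Proof.
move=> tau_ge0 a_ge0 b_gt0 ab.
have bq : 0 < b ^+ q by rewrite exprn_gt0.
have ab_ge0 : 0 <= b ^+ q.+1 - a ^+ q.+1.
  by rewrite subr_ge0 lerXn2r ?nnegrE // ltW.
have l_ge0 : 0 <= q.+1%:R * tau * b ^+ q by rewrite !mulr_ge0 // ltW.
rewrite ler_pXn2r ?nnegrE //.
move=> /le_trans/(_ (exprSB_le q a_ge0 ab)).
rewrite -!mulrA ler_pM2l ?ltr0n // mulrC ler_pM2l //; lra.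
Qed.

End ScalarInequalities.

(** * One step of the method decreases the energy *)

Section Step.
Variables (R : realType) (n : nat).

Definition potential (mu A : R) (h f : 'rV[R]_n -> R) (xs x z : 'rV[R]_n) : R :=
  A * (f x - f xs) + (1 + mu * A) * bregman h xs z.

Lemma uniformly_convex_bregman_ge0 (p : nat) (h : 'rV[R]_n -> R) u v :
  uniformly_convex p 1 h -> 0 <= bregman h u v.
Proof.
move=> /(_ v u); apply: le_trans.
by rewrite mulr_ge0 ?exprn_ge0 ?enorm_ge0.
Qed.

(** Up to an additive constant, the objective that defines z' is a linear
    form plus a multiple of h, so grad_minimizer applies. *)
Lemma mirror_step_optimality (mu c al : R) (h : 'rV[R]_n -> R) g x z z' :
  (forall u, differentiable h u) -> 0 < c ->
  minimizer (fun w => al / c * (dotv g w + mu * bregman h w x) + bregman h w z)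
    z' ->
  forall v, al * (dotv g v + mu * dotv (grad h z' - grad h x) v)
    + c * dotv (grad h z' - grad h z) v = 0.
Proof.
move=> dh c_gt0 minz' v.
pose l := (al / c) *: (g - mu *: grad h x) - grad h z.
pose d := - (al / c * mu * (h x - dotv (grad h x) x)) - h z + dotv (grad h z) z.
have FE w : al / c * (dotv g w + mu * bregman h w x) + bregman h w z =
    (al / c * mu + 1) * h w + dotv l w + d.
  rewrite /l /d /bregman !(dotvBl, dotvZl, dotvBr); ring.
have /(grad_minimizer v (dh z')) :
    minimizer (fun w => (al / c * mu + 1) * h w + dotv l w + d) z'.
  by move=> w; rewrite -!FE.
move=> /(congr1 ( *%R c)); rewrite mulr0 => <-.
rewrite /l !(dotvBl, dotvZl); field; exact: lt0r_neq0.
Qed.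

(** The value of rate_const is the one for which the bound on B - A is exactly
    what scaled_Young requires to absorb the term (B - A) <g, z - z'>. *)
Lemma potential_step (q : nat) (mu s M A B : R) (h f : 'rV[R]_n -> R)
    (xs x y z x' z' : 'rV[R]_n) :
  (0 < q)%N -> 0 <= mu -> 0 < s -> 0 < M ->
  (forall u, differentiable h u) -> uniformly_convex q.+1 1 h ->
  (forall u v, mu * bregman h u v <= bregman f u v) ->
  0 <= A -> A <= B -> 0 < B ->
  (B - A) ^+ q.+1 <=
    rate_const q.+1 M * q.+1%:R ^+ q.+1 * s * B ^+ q * (1 + mu * A) ->
  y = x + ((B - A) / B) *: (z - x) ->
  M * s `^ (q%:R)^-1 * enorm (grad f x') `^ (q.+1%:R / q%:R)
    <= dotv (grad f x') (y - x') ->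
  minimizer (fun w => (B - A) / (1 + mu * A)
      * (dotv (grad f x') w + mu * bregman h w x') + bregman h w z) z' ->
  potential mu B h f xs x' z' <= potential mu A h f xs x z.
Proof.
move=> q_gt0 mu_ge0 s_gt0 M_gt0 dh uch ucf A_ge0 AB B_gt0 stepAB yE gain minz'.
have c_gt0 : 0 < 1 + mu * A by rewrite ltr_pwDl ?mulr_ge0.
have al_ge0 : 0 <= B - A by rewrite subr_ge0.
have opt := mirror_step_optimality dh c_gt0 minz' (xs - z').
set g := grad f x' in gain minz' opt *.
(* With u = |g|^(1/q), all the powers of |g| that occur are integer powers
   of u. *)
set u := enorm g `^ q%:R^-1.
have u_ge0 : 0 <= u by exact: powR_ge0.
have gE : enorm g = u ^+ q by rewrite exprn_powRV ?enorm_ge0.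
have : enorm g `^ (q.+1%:R / q%:R) = u ^+ q.+1.
  by rewrite mulrC powRrM powR_mulrn.
move: gain => /[swap] -> gain.
set sg := s `^ q%:R^-1 in gain.
have sg_ge0 : 0 <= sg by exact: powR_ge0.
have sgE : sg ^+ q = s by rewrite exprn_powRV ?ltW.
have young : (B - A) * u ^+ q * enorm (z' - z) <=
    (1 + mu * A) / q.+1%:R * enorm (z' - z) ^+ q.+1 + B * (M * sg) * u ^+ q.+1.
  apply: scaled_Young => //; first by rewrite !mulr_ge0 // ltW.
  - exact: ltW.
  - exact: enorm_ge0.
  have q0 : q%:R != 0 :> R by rewrite pnatr_eq0 -lt0n.
  have qq_ge0 : 0 <= q%:R ^+ q :> R by rewrite exprn_ge0.
  apply: le_trans (ler_wpM2r qq_ge0 stepAB) _.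
  rewrite /rate_const /= !exprMn sgE exprVn exprS.
  rewrite le_eqVlt; apply/orP; left; apply/eqP.
  move: (q.+1%:R) (pnatr_eq0 R q.+1) => m m0.
  by field; rewrite expf_neq0 // m0.
have cs : dotv g z - dotv g z' <= u ^+ q * enorm (z' - z).
  by rewrite -dotvBr -gE -(enormN (z' - z)) opprB CauchySchwarz_dotv.
have {}cs := ler_wpM2l al_ge0 cs.
have yB : B * dotv g y = A * dotv g x + (B - A) * dotv g z.
  rewrite yE dotvDr dotvZr dotvBr; field; exact: lt0r_neq0.
have {}gain := ler_wpM2l (ltW B_gt0) gain.
have uc := ler_wpM2l (ltW c_gt0) (uch z z').
have strong := ler_wpM2l al_ge0 (ucf xs x').
have cvx : 0 <= A * bregman f x x'.
  rewrite mulr_ge0 //; apply: le_trans (ucf _ _).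
  by rewrite mulr_ge0 ?(uniformly_convex_bregman_ge0 _ _ uch).
have reg : 0 <= (B - A) * mu * bregman h z' x'.
  by rewrite !mulr_ge0 ?(uniformly_convex_bregman_ge0 _ _ uch).
move: strong cvx reg uc gain opt; rewrite /potential /bregman -/g.
rewrite !(dotvBl, dotvBr) mul1r => strong cvx reg uc gain opt.
(* What remains is the sum of these inequalities; the powers are abstracted so
   that they are seen as atoms. *)
move: (enorm (z' - z)) (enorm (z' - z) ^+ q.+1) (u ^+ q.+1) (u ^+ q)
  (q.+1%:R^-1) young cs uc gain => t tp up uq pV young cs uc gain.
lra.
Qed.

End Step.

(** * Growth of the weights A_k *)

Section Weights.
Variables (R : realType) (q : nat) (mu s C : R) (A : nat -> R).
Hypotheses (mu_ge0 : 0 <= mu) (s_gt0 : 0 < s) (C_gt0 : 0 < C).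
Hypothesis A0 : A 0%N = 0.
Hypothesis AS : forall k : nat,
  largest [set a : R | (a - A k) ^+ q.+1
    - C * q.+1%:R ^+ q.+1 * s * a ^+ q * (1 + mu * A k) <= 0] (A k.+1).

Let kappa_gt0 : 0 < C * q.+1%:R ^+ q.+1 * s.
Proof. by rewrite !mulr_gt0 ?exprn_gt0 ?ltr0n. Qed.

Lemma weight_ge0_le k : 0 <= A k /\ A k <= A k.+1.
Proof.
have le k0 : 0 <= A k0 -> A k0 <= A k0.+1.
  move=> Ak_ge0; apply: (AS k0).2; rewrite /= subrr expr0n /= sub0r oppr_le0.
  by rewrite !mulr_ge0 ?exprn_ge0 ?addr_ge0 ?mulr_ge0 ?(ltW C_gt0) ?(ltW s_gt0).
suff ge0 : 0 <= A k by split; rewrite ?le.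
by elim: k => [|k IH]; rewrite ?A0 //; exact: le_trans (le k IH).
Qed.

(** For A_0 = 0 the value C p^p s is a root of the defining inequality. When
    q > 0, so is 0, hence positivity of A_1 needs maximality. *)
Lemma weight1_ge : C * q.+1%:R ^+ q.+1 * s <= A 1%N.
Proof.
by apply: (AS 0).2; rewrite /= A0 subr0 mulr0 addr0 mulr1 -exprS subrr.
Qed.

Lemma weight_gt0 k : 0 < A k.+1.
Proof.
elim: k => [|k IH]; first exact: lt_le_trans weight1_ge.
exact: lt_le_trans (weight_ge0_le k.+1).2.
Qed.

Lemma weight_step_le k :
  (A k.+1 - A k) ^+ q.+1 <=
    C * q.+1%:R ^+ q.+1 * s * A k.+1 ^+ q * (1 + mu * A k).
Proof. by rewrite -subr_le0; exact: (AS k).1. Qed.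

(** Bounding 1 + mu A_k from below by 1, root_growth applies with
    tau = (C s)^(1/p). *)
Lemma weight_poly_ge k : C * s * k%:R ^+ q.+1 <= A k.
Proof.
have Cs_ge0 : 0 <= C * s by rewrite mulr_ge0 ?ltW.
pose tau := (C * s) `^ q.+1%:R^-1.
have tau_ge0 : 0 <= tau by exact: powR_ge0.
pose root j := A j `^ q.+1%:R^-1.
have rootE j : root j ^+ q.+1 = A j by rewrite exprn_powRV ?(weight_ge0_le j).1.
have root_ge0 j : 0 <= root j by exact: powR_ge0.
have root_ge : k%:R * tau <= root k.
  elim: k => [|k IH]; first by rewrite mul0r.
  rewrite mulrSr mulrDl mul1r; apply: le_trans (lerD IH (lexx tau)) _.
  have [Ak_ge0 AkS] := weight_ge0_le k.
  apply: (@root_growth _ q) => //.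
  - by rewrite powR_gt0 ?weight_gt0.
  - by apply: ge0_ler_powR; rewrite ?nnegrE ?invr_ge0 // (le_trans Ak_ge0).
  rewrite !rootE; apply: le_trans (largest_ge (AS k)).
  rewrite !exprMn exprn_powRV // exprAC rootE.
  have -> : q.+1%:R ^+ q.+1 * (C * s) * A k.+1 ^+ q =
    C * q.+1%:R ^+ q.+1 * s * A k.+1 ^+ q by ring.
  rewrite ler_peMr ?lerDl ?mulr_ge0 ?exprn_ge0 ?(ltW C_gt0) ?(ltW s_gt0) //.
  exact: ltW (weight_gt0 k).
rewrite -rootE -[C * s](@exprn_powRV _ _ q.+1) // -exprMn mulrC.
by rewrite lerXn2r ?nnegrE ?mulr_ge0.
Qed.

Local Notation rho :=
  (C `^ q.+1%:R^-1 * q.+1%:R * mu `^ q.+1%:R^-1 * s `^ q.+1%:R^-1).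

Let rho_ge0 : 0 <= rho.
Proof. by rewrite !mulr_ge0 ?powR_ge0. Qed.

(** Bounding 1 + mu A_k from below by mu A_k, and A_{k+1}^q by A_k^q, the
    right-hand side of the recurrence becomes (rho A_k)^p. *)
Lemma weight_geom_step k : (1 + rho) * A k <= A k.+1.
Proof.
have [Ak_ge0 AkS] := weight_ge0_le k.
suff : rho * A k <= A k.+1 - A k by rewrite mulrDl mul1r; lra.
rewrite -(@ler_pXn2r _ q.+1) ?nnegrE ?subr_ge0 ?(mulr_ge0 rho_ge0) //.
apply: le_trans (largest_ge (AS k)).
rewrite !exprMn !exprn_powRV ?(ltW C_gt0) ?(ltW s_gt0) // [A k ^+ _]exprSr.
have -> : C * q.+1%:R ^+ q.+1 * mu * s * (A k ^+ q * A k) =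
  C * q.+1%:R ^+ q.+1 * s * (A k ^+ q * (mu * A k)) by ring.
rewrite -[X in _ <= X]mulrA ler_wpM2l ?(ltW kappa_gt0) //.
rewrite ler_pM ?mulr_ge0 ?exprn_ge0 //.
  by rewrite lerXn2r ?nnegrE ?(le_trans Ak_ge0).
by rewrite lerDr.
Qed.

Lemma weight_geom_ge k :
  C * q.+1%:R ^+ q.+1 * s / (1 + rho) * (1 + rho) ^+ k.+1 <= A k.+1.
Proof.
have rho1_gt0 : 0 < 1 + rho by rewrite ltr_pwDl.
rewrite [_ ^+ k.+1]exprS mulrA divfK ?lt0r_neq0 //.
elim: k => [|k IH]; first by rewrite expr0 mulr1 weight1_ge.
apply: le_trans (weight_geom_step k.+1).
by rewrite [_ ^+ k.+1]exprS mulrCA ler_wpM2l // ltW.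
Qed.

End Weights.

(** * Convergence rates *)

Theorem mainTheorem17 (R : realType) (p : nat) (mu s M : R)
    (hp : (2 <= p)%N) (hmu : 0 <= mu) (hs : 0 < s) (hM : 0 < M) :
  let C : R := rate_const p M in
  exists2 K : R, 0 < K &
  forall (n : nat) (h f : 'rV[R]_n -> R) (xstar : 'rV[R]_n)
    (G : 'rV[R]_n -> 'rV[R]_n) (A : nat -> R) (x y z : nat -> 'rV[R]_n),
  continuously_differentiable h ->
  uniformly_convex p 1 h ->
  continuously_differentiable f ->
  times_differentiable p.-1 f ->
  uniformly_convex_wrt mu h f ->
  smooth_of_order p.-1 ((p.-1)`!%:R / s) f ->
  minimizer f xstar ->
  tensor_update p s M f G ->
  A 0%N = 0 ->
  (forall k : nat,
     largest [set a : R | (a - A k) ^+ p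
                - C * p%:R ^+ p * s * a ^+ p.-1 * (1 + mu * A k) <= 0]
       (A k.+1)) ->
  z 0%N = x 0%N ->
  (forall k : nat,
     y k = x k + ((A k.+1 - A k) / A k.+1) *: (z k - x k)) ->
  (forall k : nat, x k.+1 = G (y k)) ->
  (forall k : nat,
     minimizer (fun w : 'rV[R]_n =>
         (A k.+1 - A k) / (1 + mu * A k)
           * (dotv (grad f (x k.+1)) w + mu * bregman h w (x k.+1))
         + bregman h w (z k))
       (z k.+1)) ->
  forall k : nat, (1 <= k)%N ->
    f (x k) - f xstar <=
      K * Num.min (1 / k%:R ^+ p)
            ((1 + C `^ (p%:R)^-1 * p%:R * mu `^ (p%:R)^-1 * s `^ (p%:R)^-1)
               ^- k)
        * bregman h xstar (x 0%N).
Proof.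
case: p hp => [//|q] q_gt0 C; rewrite ltnS in q_gt0.
have C_gt0 : 0 < C.
  by rewrite mulr_gt0 ?invr_gt0 ?ltr0n // exprn_gt0 // divr_gt0 // ltr0n.
set r := C `^ q.+1%:R^-1 * q.+1%:R * mu `^ q.+1%:R^-1 * s `^ q.+1%:R^-1.
have r1_gt0 : 0 < 1 + r by rewrite ltr_pwDl // !mulr_ge0 ?powR_ge0.
pose kappa := C * q.+1%:R ^+ q.+1 * s.
have kappa_gt0 : 0 < kappa.
  by rewrite mulr_gt0 // mulr_gt0 // exprn_gt0 // ltr0n.
have Cs_gt0 : 0 < C * s by rewrite mulr_gt0.
(* The two summands serve the polynomial and the geometric rate. The factor
   1 + r is there because the geometric growth of A_k starts at A_1 only, from a
   value at least kappa. *)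
pose K := (C * s)^-1 + (1 + r) / kappa.
have K_gt0 : 0 < K by rewrite addr_gt0 ?divr_gt0 ?invr_gt0.
exists K => // n h f xstar G A x y z [dh _] uch _ _ [_ ucf] _ _ [N _ tensorG].
move=> A0 AS z0 yE xE zmin [//|k] _.
have decr j :
    potential mu (A j) h f xstar (x j) (z j) <= bregman h xstar (x 0%N).
  elim: j => [|j].
    by rewrite /potential A0 mul0r add0r mulr0 addr0 mul1r z0.
  apply: le_trans; have [Aj_ge0 AjS] := weight_ge0_le hmu hs C_gt0 A0 AS j.
  apply: (@potential_step _ _ q mu s M _ _ h f xstar _ (y j)) => //.
  - exact: weight_gt0 hmu hs C_gt0 A0 AS j.
  - exact: weight_step_le AS j.
  - by rewrite xE; exact: (tensorG (y j)).2.
have A_gt0 := weight_gt0 hmu hs C_gt0 A0 AS k.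
have D_ge0 w : 0 <= bregman h xstar w.
  exact: uniformly_convex_bregman_ge0 uch.
have gapA : A k.+1 * (f (x k.+1) - f xstar) <= bregman h xstar (x 0%N).
  apply: le_trans (decr k.+1); rewrite lerDl mulr_ge0 //.
  by rewrite addr_ge0 ?mulr_ge0 // ltW.
have rate : 1 <= A k.+1 * (K * Num.min (1 / k.+1%:R ^+ q.+1) ((1 + r) ^- k.+1)).
  have poly := weight_poly_ge hmu hs C_gt0 A0 AS k.+1.
  have geom := weight_geom_ge hmu hs C_gt0 A0 AS k.
  have kp_gt0 : 0 < k.+1%:R ^+ q.+1 :> R by rewrite exprn_gt0 ?ltr0n.
  have rk_gt0 : 0 < (1 + r) ^+ k.+1 by rewrite exprn_gt0.
  have rk_gt0' : 0 < (1 + r) / kappa by rewrite divr_gt0.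
  have K1 : (C * s)^-1 <= K by rewrite lerDl ltW.
  have K2 : (1 + r) / kappa <= K by rewrite lerDr invr_ge0 ltW.
  rewrite mulrA minEle; case: ifP => _; rewrite ?div1r ler_pdivlMr // mul1r.
    have Csk_ge0 := mulr_ge0 (ltW Cs_gt0) (ltW kp_gt0).
    have CsV_ge0 : 0 <= (C * s)^-1 by rewrite invr_ge0 ltW.
    apply: le_trans (ler_pM Csk_ge0 CsV_ge0 poly K1).
    by rewrite mulrAC divff ?mul1r ?(lt0r_neq0 Cs_gt0).
  have geom_ge0 := mulr_ge0 (ltW (divr_gt0 kappa_gt0 r1_gt0)) (ltW rk_gt0).
  apply: le_trans (ler_pM geom_ge0 (ltW rk_gt0') geom K2).
  rewrite -/kappa -/r le_eqVlt; apply/orP; left; apply/eqP.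
  have kappa_neq0 := lt0r_neq0 kappa_gt0; have r1_neq0 := lt0r_neq0 r1_gt0.
  by rewrite mulrAC mulrA divfK ?divff ?mul1r.
rewrite -(ler_pM2l A_gt0); apply: le_trans gapA _.
by rewrite mulrA ler_peMl.
Qed.
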